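(* (Finite case.) Let $L$ be finite and let $\mu$ be a choice function on the sets of models, i.e. $\mu(\Sigma)\subseteq\Sigma$ for all $\Sigma\subseteq\{0,1\}^L$. Then $\mathrel{|\!\sim}$ has interpolation of the form $\varphi\mathrel{|\!\sim}\alpha\vdash\psi$ if and only if $I(\Sigma)\subseteq I(\mu(\Sigma))$ holds for all $\Sigma$. (Infinite case.) If $L$ is infinite, the same equivalence holds (with $\Sigma$ ranging over the definable model sets) under the additional prerequisite that $\mu(\Sigma)$ is definable whenever $\Sigma$ is.
   Context: Classical two-valued propositional logic with variable set $L$; models are elements of $\{0,1\}^L$. A set $\Sigma\subseteq\{0,1\}^L$ is definable if $\Sigma=M(T)$, the set of models of some set $T$ of formulas (for finite $L$ every set of models is definable). For $\Sigma\subseteq\{0,1\}^L$, $I(\Sigma)$ (the irrelevant, or inessential, variables) is the set of all $i\in L$ with $\Sigma=(\Sigma\restriction(L\setminus\{i\}))\times\{0,1\}^{\{i\}}$ (up to re-ordering), where $\Sigma\restriction Y=\{\sigma\restriction Y:\sigma\in\Sigma\}$; and $R(\Sigma)=L\setminus I(\Sigma)$ (the relevant variables). For definable $\Sigma,\Sigma'$, $\Sigma\mathrel{|\!\sim}\Sigma'$ means $\mu(\Sigma)\subseteq\Sigma'$. ''$\mathrel{|\!\sim}$ has interpolation'' (of the form $\varphi\mathrel{|\!\sim}\alpha\vdash\psi$) means: for all definable $\Sigma,\Sigma'$ with $\mu(\Sigma)\subseteq\Sigma'$ there is a definable $\Sigma''$ with $R(\Sigma'')\subseteq R(\Sigma)\cap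 R(\Sigma')$ and $\mu(\Sigma)\subseteq\Sigma''\subseteq\Sigma'$. *)

(* Defs.v *)
From mathcomp Require Import all_boot.
From mathcomp Require Import boolp classical_sets functions cardinality.

Set Implicit Arguments.
Unset Strict Implicit.
Unset Printing Implicit Defensive.

Local Open Scope classical_set_scope.

Inductive formula (L : Type) : Type :=
| Var of L
| Falsum
| Neg of formula L
| And of formula L & formula L
| Or of formula L & formula L
| Imp of formula L & formula L.

Definition model (L : Type) : Type := L -> bool.

Fixpoint sat (L : Type) (s : model L) (phi : formula L) : bool :=
  match phi with
  | Var i => s i
  | Falsum => false
  | Neg p => ~~ sat s p
  | And p q => sat s p && sat s q
  | Or p q => sat s p || sat s q
  | Imp p q => sat s p ==> sat s q
  end.

Definition models (L : Type) (T : set (formula L)) : set (model L) :=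
  [set s | forall phi, T phi -> sat s phi].

Definition definable (L : Type) (S : set (model L)) : Prop :=
  exists T : set (formula L), S = models T.

(* A partial model over Y is a function on the subtype Y; [sigL Y s] is the
   restriction of s to Y. *)
Definition restriction (L : Type) (S : set (model L)) (Y : set L) :
    set (Y -> bool) :=
  [set sigL Y s | s in S].
Arguments restriction {L} S Y.

(* When Y and Z partition L, this is the Cartesian product of A and B, with a
   pair (a, b) identified with the model that extends both a and b. *)
Definition product (L : Type) (Y Z : set L)
    (A : set (Y -> bool)) (B : set (Z -> bool)) : set (model L) :=
  [set s | A (sigL Y s) /\ B (sigL Z s)].

Definition irrelevant (L : Type) (S : set (model L)) : set L :=
  [set i | S = product (restriction S ([set: L] `\ i))
                       [set: [set i] -> bool]].

Definition relevant (L : Type) (S : set (model L)) : set L :=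
  [set: L] `\` irrelevant S.

(* A choice function defined only on the definable model sets is represented by
   a total mu; only its values at definable S matter in [has_interpolation]. *)
Definition nonmon_conseq (L : Type) (mu : set (model L) -> set (model L))
    (S S' : set (model L)) : Prop :=
  mu S `<=` S'.

Definition has_interpolation (L : Type)
    (mu : set (model L) -> set (model L)) : Prop :=
  forall S S' : set (model L), definable S -> definable S' ->
    nonmon_conseq mu S S' ->
    exists S'' : set (model L),
      [/\ definable S'',
          relevant S'' `<=` relevant S `&` relevant S',
          nonmon_conseq mu S S''
        & S'' `<=` S'].

(* Main.v *)
Require Import Defs.
From mathcomp Require Import all_boot.
From mathcomp Require Import boolp classical_sets functions cardinality.

(** If [mu S] is definable, it can itself be taken as the right-hand side of a
    consequence of [S]; the only interpolant is then [mu S], and the condition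
    on its relevant variables says exactly that every variable irrelevant for
    [S] is irrelevant for [mu S].

    Conversely, put [A = mu S], so that [relevant A] lies in [relevant S], and
    let [A `<=` B] with [B] definable.  It suffices to interpolate between [A]
    and [B] in the monotone sense ([definable_interpolant]).  For this, take
    all formulas true on [A] that depend on no variable irrelevant for [A] or
    for [B].  That their models lie in [B] is a matter of one formula [phi]
    valid on [B] at a time: quantifying universally, by
    [phi[i:=0] /\ phi[i:=1]], over the irrelevant variables of [B], and then
    over those of [A], yields a stronger formula that is still valid on [A]
    ([strengthen_irrelevant]).  As a formula depends on finitely many variables
    only, finitely many quantifications suffice, even when [L] is infinite.

    For finite [L] all model sets are definable ([finite_definable]), so both
    cases are instances of one equivalence ([interpolationP]). *)

Local Open Scope classical_set_scope.

(** * Changing one variable of a model *)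

Definition update {L : eqType} (s : model L) (i : L) (b : bool) : model L :=
  fun j => if j == i then b else s j.

Lemma update_id (L : eqType) (s : model L) (i : L) : update s i (s i) = s.
Proof. by apply/funext => j; rewrite /update; case: eqP => [->|]. Qed.

Lemma update_update (L : eqType) (s : model L) (i : L) (b c : bool) :
  update (update s i b) i c = update s i c.
Proof. by apply/funext => j; rewrite /update; case: eqP. Qed.

Lemma update_comm (L : eqType) (s : model L) (i j : L) (b c : bool) :
  i != j -> update (update s i b) j c = update (update s j c) i b.
Proof.
move=> /eqP ij; apply/funext => k; rewrite /update.
by do 2 case: eqP => // ?; subst.
Qed.

(** The product decomposition defining irrelevance amounts to closure under
    changing the value of [i], because two models have the same restriction to
    the complement of [i] exactly when each is an update of the other at [i]. *)
Lemma irrelevantP (L : eqType) (S : set (model L)) (i : L) :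
  irrelevant S i <-> forall s b, S s -> S (update s i b).
Proof.
split=> [/= SE s b Ss|Supd /=].
- rewrite SE; split=> //; exists s => //.
  apply/eq_sigLP => j; rewrite inE => -[_ /= /eqP ji].
  by rewrite /update (negbTE ji).
- apply/seteqP; split=> [s Ss|s [[t St /eq_sigLP ts] _]].
    by split=> //; exists s.
  suff -> : s = update t i (s i) by exact: Supd.
  apply/funext => j; rewrite /update; case: eqP => [->//|ji].
  by rewrite ts// inE.
Qed.

(** * Variables on which a formula does not depend *)

Definition independent {L : eqType} (phi : formula L) (i : L) : Prop :=
  forall s b, sat (update s i b) phi = sat s phi.

Fixpoint vars {L : Type} (phi : formula L) : seq L :=
  match phi with
  | Var i => [:: i]
  | Falsum => [::]
  | Neg p => vars p
  | And p q | Or p q | Imp p q => vars p ++ vars q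
  end.

Lemma notin_vars_independent (L : eqType) (phi : formula L) (i : L) :
  i \notin vars phi -> independent phi i.
Proof.
move=> + s b.
elim: phi => //= [j|p IHp|p IHp q IHq|p IHp q IHq|p IHp q IHq].
- by rewrite inE /update eq_sym => /negbTE ->.
- by move=> /IHp ->.
- by rewrite mem_cat negb_or => /andP[/IHp -> /IHq ->].
- by rewrite mem_cat negb_or => /andP[/IHp -> /IHq ->].
- by rewrite mem_cat negb_or => /andP[/IHp -> /IHq ->].
Qed.

Lemma independent_irrelevant (L : eqType) (T : set (formula L)) (i : L) :
  (forall phi, T phi -> independent phi i) -> irrelevant (models T) i.
Proof.
move=> Ti; apply/irrelevantP => s b sT phi Tphi.
by rewrite Ti//; exact: sT.
Qed.

(** * Eliminating variables by universal quantification *)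

Fixpoint subst_const {L : eqType} (i : L) (b : bool) (phi : formula L) :
    formula L :=
  match phi with
  | Var j => if j == i then (if b then Neg (Falsum L) else Falsum L) else Var j
  | Falsum => Falsum L
  | Neg p => Neg (subst_const i b p)
  | And p q => And (subst_const i b p) (subst_const i b q)
  | Or p q => Or (subst_const i b p) (subst_const i b q)
  | Imp p q => Imp (subst_const i b p) (subst_const i b q)
  end.

Lemma sat_subst_const (L : eqType) (i : L) (b : bool) (phi : formula L) s :
  sat s (subst_const i b phi) = sat (update s i b) phi.
Proof.
elim: phi => //= [j|p ->|p -> q ->|p -> q ->|p -> q ->] //.
by rewrite /update; case: eqP => // _; case: b.
Qed.

Definition forall_var {L : eqType} (i : L) (phi : formula L) : formula L :=
  And (subst_const i true phi) (subst_const i false phi).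

Lemma sat_forall_var (L : eqType) (i : L) (phi : formula L) s :
  sat s (forall_var i phi) <-> forall b, sat (update s i b) phi.
Proof.
rewrite /= !sat_subst_const; split=> [/andP[st sf] []//|H].
by rewrite !H.
Qed.

Lemma forall_var_entails (L : eqType) (i : L) (phi : formula L) s :
  sat s (forall_var i phi) -> sat s phi.
Proof. by move=> /sat_forall_var/(_ (s i)); rewrite update_id. Qed.

Lemma independent_forall_var (L : eqType) (i : L) (phi : formula L) :
  independent (forall_var i phi) i.
Proof. by move=> s b; rewrite /= !sat_subst_const !update_update. Qed.

Lemma independent_forall_var_mono (L : eqType) (i j : L) (phi : formula L) :
  independent phi j -> independent (forall_var i phi) j.
Proof.
have [->|ij] := eqVneq i j; first by move=> _; exact: independent_forall_var.
move=> phij s b.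
by rewrite /= !sat_subst_const !(@update_comm _ _ j i) 1?eq_sym// !phij.
Qed.

(** Quantifying over a variable irrelevant for [S] preserves validity on [S]:
    both truth values of the variable already occur within [S]. *)
Lemma valid_forall_var (L : eqType) (S : set (model L)) (i : L) phi :
  irrelevant S i -> (forall s, S s -> sat s phi) ->
  forall s, S s -> sat s (forall_var i phi).
Proof.
move=> /irrelevantP Si Sphi s Ss; apply/sat_forall_var => b.
exact/Sphi/Si.
Qed.

(** The clause on independence being inherited from [phi] to [psi] allows the
    construction to be iterated, for two different model sets. *)
Lemma strengthen_irrelevant (L : eqType) (S : set (model L)) phi :
  (forall s, S s -> sat s phi) ->
  exists psi, [/\ forall s, S s -> sat s psi,
                  forall s, sat s psi -> sat s phi,
                  forall i, independent phi i -> independent psi i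
                & forall i, irrelevant S i -> independent psi i].
Proof.
move=> Sphi.
suff [psi [Spsi psiphi ind indvars]] :
    exists psi, [/\ forall s, S s -> sat s psi,
                    forall s, sat s psi -> sat s phi,
                    forall i, independent phi i -> independent psi i
                  & forall i, i \in vars phi -> irrelevant S i ->
                      independent psi i].
  exists psi; split=> // i Si.
  have [/indvars|/notin_vars_independent] := boolP (i \in vars phi); first exact.
  exact: ind.
(* The list of variables still to be treated is decoupled from the formula,
   which changes at each quantification. *)
elim: (vars phi) => [|j l [psi [Spsi psiphi ind indl]]]; first by exists phi.
have [Sj|Sj] := pselect (irrelevant S j).
- exists (forall_var j psi); split.
  + exact: valid_forall_var.
  + by move=> s /forall_var_entails; exact: psiphi.
  + by move=> i /ind; exact: independent_forall_var_mono.
  + move=> i; rewrite inE => /predU1P[-> _|il Si].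
      exact: independent_forall_var.
    by apply: independent_forall_var_mono; exact: indl.
- exists psi; split=> // i; rewrite inE => /predU1P[->//|]; exact: indl.
Qed.

(** * Interpolation *)

Lemma definable_interpolant (L : eqType) (A B : set (model L)) :
  definable B -> A `<=` B ->
  exists C, [/\ definable C, relevant C `<=` relevant A `&` relevant B,
                A `<=` C & C `<=` B].
Proof.
move=> [T BT] AB.
pose U : set (formula L) := [set phi | (forall s, A s -> sat s phi) /\
  forall i, irrelevant A i \/ irrelevant B i -> independent phi i].
exists (models U); split.
- by exists U.
- move=> i [_ Ui].
  by split; split=> // Hi; apply/Ui/independent_irrelevant => phi [_];
    apply; [left|right].
- by move=> s As phi [+ _]; exact.
- move=> s Us; rewrite BT => phi Tphi.
  have Bphi t : B t -> sat t phi by rewrite BT; exact.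
  have [chi [Bchi chiphi _ indB]] := strengthen_irrelevant _ _ _ Bphi.
  have Achi t : A t -> sat t chi by move=> /AB; exact: Bchi.
  have [psi [Apsi psichi ind indA]] := strengthen_irrelevant _ _ _ Achi.
  apply/chiphi/psichi/Us; split=> // i [|/indB]; [exact: indA|exact: ind].
Qed.

Lemma interpolationP (L : eqType) (mu : set (model L) -> set (model L)) :
  (forall S, definable S -> definable (mu S)) ->
  has_interpolation mu <->
  forall S, definable S -> irrelevant S `<=` irrelevant (mu S).
Proof.
move=> mudef; split=> [interp S Sdef i Si|irr S B Sdef Bdef SB].
- have [C [_ RC muC Cmu]] := interp S (mu S) Sdef (mudef S Sdef) (@subset_refl _ _).
  have CE : C = mu S by apply/seteqP.
  by apply: contrapT => nmui; have [|[]] := RC i; first by rewrite CE.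
- have [C [Cdef RC AC CB]] := definable_interpolant _ _ _ Bdef SB.
  exists C; split=> // i /RC [[_ nAi] Bi]; split=> //; split=> // Si.
  exact/nAi/(irr S).
Qed.

(** * Definability over finitely many variables *)

(** A clause refuted by the single model [s], among models that agree with it
    outside [l]. *)
Definition differs_from {L : Type} (s : model L) (l : seq L) : formula L :=
  foldr (fun i => Or (if s i then Neg (Var i) else Var i)) (Falsum L) l.

Lemma sat_differs_from (L : Type) (s t : model L) (l : seq L) :
  sat t (differs_from s l) = has (fun i => t i != s i) l.
Proof. by elim: l => //= i l ->; case: (s i) => /=; case: (t i). Qed.

(** A model outside [S] is excluded by the clause that it alone refutes. *)
Lemma finite_definable (L : eqType) (S : set (model L)) :
  finite_set [set: L] -> definable S.
Proof.
move=> /finite_seqP[l lE].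
have in_l i : i \in l by have : [set: L] i by []; rewrite lE.
exists [set phi | forall s, S s -> sat s phi].
apply/seteqP; split=> [s Ss phi|s sT]; first exact.
apply: contrapT => nSs.
have : sat s (differs_from s l).
  apply: sT => t St; rewrite sat_differs_from.
  apply: contrapT => /negP/hasPn ts; apply: nSs.
  suff -> : s = t by [].
  by apply/funext => i; apply/esym/eqP; rewrite -[_ == _]negbK; exact: ts.
by rewrite sat_differs_from => /hasP[i _]; rewrite eqxx.
Qed.

Theorem proposition5p3p2 (L : Type) (mu : set (model L) -> set (model L)) :
  (finite_set [set: L] ->
   (forall S : set (model L), mu S `<=` S) ->
   (has_interpolation mu <->
    forall S : set (model L), irrelevant S `<=` irrelevant (mu S)))
  /\
  (infinite_set [set: L] ->
   (forall S : set (model L), definable S -> mu S `<=` S) ->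
   (forall S : set (model L), definable S -> definable (mu S)) ->
   (has_interpolation mu <->
    forall S : set (model L), definable S ->
      irrelevant S `<=` irrelevant (mu S))).
Proof.
(* The alias {classic L} provides decidable equality on the bare type L. *)
split=> [Lfin _|_ _ mudef]; last exact: (interpolationP {classic L}).
have def (S : set (model L)) : definable S.
  exact: (finite_definable {classic L}).
have [interp_irr irr_interp] :=
  interpolationP {classic L} mu (fun S _ => def (mu S)).
by split=> [/interp_irr irr S|irr]; [exact: irr|apply: irr_interp => S _].
Qed.
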